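(* Let $b,v\ge 2$ and $k,s\ge 1$ be integers, and let $D=D(b,v,k)$ be the class of all connected block designs (primals) with $v$ controls and $b$ blocks each of size $k$ (not necessarily binary or equireplicate). Put $$L=\frac{(v-1)^2}{b(k-1)},\qquad \widetilde L=\frac{(b-1)^2}{bk-v},\qquad H=\frac{h}{f+1}+\frac{v-h}{f},$$ where $f$ is the largest integer not exceeding $bk/v$ and $h=bk-vf$. Then for every primal $d$ in $D$ the $A$-criteria $A_{cc}$, $A_{tt}(s)$, $A_{ct}$ of $d$ satisfy (a) $A_{cc}\ge A_{cc}^{\rm bound}:=\dfrac{2L}{v-1}$; (b) $A_{tt}(s)\ge A_{tt}^{\rm bound}(s):=2\left[1+\dfrac{s}{bs-1}\,\widetilde L\right]$; (c) $A_{ct}\ge A_{ct}^{\rm bound}:=1+\dfrac{k+1}{vk}\,H+\dfrac1b\,\widetilde L-\dfrac{1}{bk}$.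
   Context: A block design (primal) $d$ with $v$ controls and $b$ blocks of size $k$ is given by its $v\times b$ incidence matrix $N=(n_{ij})$, where the nonnegative integer $n_{ij}$ is the number of times the $i$th control appears in the $j$th block; every column sum of $N$ equals $k$. The replication numbers are $r_i=\sum_{j=1}^b n_{ij}$, and $R=\mathrm{diag}(r_1,\dots,r_v)$. The design is connected if the bipartite graph on the $v$ controls and $b$ blocks, with control $i$ joined to block $j$ whenever $n_{ij}>0$, is connected (equivalently, all contrasts of control effects are estimable and every control appears; in particular all $r_i\ge1$). Neither $n_{ij}\in\{0,1\}$ nor equality of the $r_i$ is assumed. Let $C=R-\frac1k NN^T$ and $\widetilde C=kI_b-N^TR^{-1}N$ be the intrablock matrices of $d$ and of its dual, and let $C^+$, $\widetilde C^+$ be their Moore–Penrose inverses. Let $e_1,\dots,e_v$ be the unit vectors of order $v$, $\tilde e_1,\dots,\tilde e_b$ the unit vectors of order $b$, and $\xi_{ij}=\tilde e_j-N^TR^{-1}e_i$. Define $$V_{cc}(i,i^* )=(e_i-e_{i^*})^TC^+(e_i-e_{i^*}),\quad V_{tt}(j,j^* )=(\tilde e_j-\tilde e_{j^*})^T\widetilde C^+(\tilde e_j-\tilde e_{j^*}),$$ $$V_{ct}(i,j)=1+\frac1{r_i}+\xi_{ij}^T\widetilde C^+\xi_{ij}.$$ The $A$-criteria (average variances, in units of the error variance, of the best linear unbiased estimators of the control-vs-control, test-vs-test and control-vs-test pairwise contrasts, when each block of $d$ is augmented by $s$ unreplicated test treatments) are $$A_{cc}=\frac{2}{v(v-1)}\sum_{1\le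 i<i^*\le v}V_{cc}(i,i^* ),\qquad A_{tt}(s)=2+\frac{2s^2}{bs(bs-1)}\sum_{1\le j<j^*\le b}V_{tt}(j,j^* ),$$ $$A_{ct}=\frac1{vb}\sum_{i=1}^v\sum_{j=1}^bV_{ct}(i,j).$$ *)

(* Defs.v *)
From mathcomp Require Import all_boot all_order all_algebra.

Set Implicit Arguments.
Unset Strict Implicit.
Unset Printing Implicit Defensive.

Import Order.TTheory GRing.Theory Num.Theory.

Local Open Scope ring_scope.

Section MoorePenrose.

Variable F : realFieldType.

(* The four Penrose equations. *)
Definition is_mpinv m n (A : 'M[F]_(m, n)) (X : 'M[F]_(n, m)) : Prop :=
  [/\ A *m X *m A = A, X *m A *m X = X,
      (A *m X)^T = A *m X & (X *m A)^T = X *m A].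

(* For a full-rank factorisation A = G *m B (G of full column rank, B of full
   row rank), A^+ = B^T (B B^T)^-1 (G^T G)^-1 G^T; [mpinvP] and
   [is_mpinv_uniq] show that this is the Moore-Penrose inverse. *)
Definition mpinv m n (A : 'M[F]_(m, n)) : 'M[F]_(n, m) :=
  let G := col_base A in
  let B := row_base A in
  B^T *m invmx (B *m B^T) *m invmx (G^T *m G) *m G^T.

Lemma gram_unit m n (B : 'M[F]_(m, n)) : row_free B -> B *m B^T \in unitmx.
Proof.
move=> freeB; rewrite -row_free_unit -kermx_eq0; apply/rowV0P => u.
move/sub_kermxP; rewrite mulmxA => uBB0.
have : (u *m B) *m (u *m B)^T = 0.
  by rewrite trmx_mul mulmxA uBB0 mul0mx.
move=> uBuB0; apply: (row_free_inj freeB); rewrite mul0mx.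
move: (u *m B) uBuB0 => w /matrixP/(_ 0 0).
rewrite mxE [RHS]mxE => /eqP; rewrite psumr_eq0 => [/allP sq0|j _]; last first.
  by rewrite [w^T _ _]mxE -expr2 sqr_ge0.
apply/rowP => j; move: (sq0 j (mem_index_enum j)).
by rewrite [w^T _ _]mxE -expr2 sqrf_eq0 => /eqP ->; rewrite mxE.
Qed.

Lemma mpinvP m n (A : 'M[F]_(m, n)) : is_mpinv A (mpinv A).
Proof.
rewrite /mpinv.
move: (col_base A) (row_base A) (col_base_full A) (row_base_free A)
  (mulmx_base A).
move: (\rank A) => r G B fullG freeB <-.
have uB : B *m B^T \in unitmx by apply: gram_unit.
have uG : G^T *m G \in unitmx.
  rewrite -{2}[G]trmxK; apply: gram_unit.
  by rewrite /row_free mxrank_tr.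
set X := B^T *m _ *m _ *m _.
have AX : G *m B *m X = G *m invmx (G^T *m G) *m G^T.
  rewrite /X -!mulmxA; congr (G *m _).
  by rewrite !mulmxA mulmxV // mul1mx.
have XA : X *m (G *m B) = B^T *m invmx (B *m B^T) *m B.
  rewrite /X -!mulmxA; congr (B^T *m (_ *m _)).
  by rewrite [G^T *m (G *m B)]mulmxA mulKmx.
split.
- rewrite AX -!mulmxA; congr (G *m _).
  by rewrite [G^T *m (G *m B)]mulmxA mulKmx.
- rewrite XA /X -!mulmxA; congr (B^T *m (_ *m _)).
  by rewrite !mulmxA mulmxV // mul1mx.
- by rewrite AX !trmx_mul trmx_inv trmx_mul !trmxK mulmxA.
- by rewrite XA !trmx_mul trmx_inv trmx_mul !trmxK mulmxA.
Qed.

Lemma is_mpinv_uniq m n (A : 'M[F]_(m, n)) X Y :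
  is_mpinv A X -> is_mpinv A Y -> X = Y.
Proof.
case=> AXA XAX sAX sXA [AYA YAY sAY sYA].
have AXY : A *m X = A *m Y.
  by rewrite -sAX -{1}AYA -[A *m Y *m A *m X]mulmxA trmx_mul sAX sAY mulmxA AXA.
have XAY : X *m A = Y *m A.
  rewrite -sXA -{1}AYA -[A *m Y *m A]mulmxA mulmxA trmx_mul sXA sYA.
  by rewrite -mulmxA [A *m (X *m A)]mulmxA AXA.
by rewrite -XAX -mulmxA AXY mulmxA XAY YAY.
Qed.

End MoorePenrose.

(* A design is given by its incidence matrix N : 'M[nat]_(v, b). *)

Definition incidence_rel v b (N : 'M[nat]_(v, b)) : rel ('I_v + 'I_b)%type :=
  fun x y => match x, y with
             | inl i, inr j | inr j, inl i => (0 < N i j)%N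
             | _, _ => false
             end.

Definition connected_design v b (N : 'M[nat]_(v, b)) : Prop :=
  forall x y, connect (incidence_rel N) x y.

(* N is the incidence matrix of a design in the class D(b, v, k). *)
Definition primal b v k (N : 'M[nat]_(v, b)) : Prop :=
  (forall j, (\sum_i N i j)%N = k) /\ connected_design N.

Definition repl v b (N : 'M[nat]_(v, b)) (i : 'I_v) : nat :=
  (\sum_j N i j)%N.

Section Criteria.

Variables (F : realFieldType) (b v k : nat) (N : 'M[nat]_(v, b)).

Let Nm : 'M[F]_(v, b) := \matrix_(i, j) (N i j)%:R.

Definition repl_mx : 'M[F]_v := diag_mx (\row_i (repl N i)%:R).

Definition intrablock : 'M[F]_v := repl_mx - k%:R^-1 *: (Nm *m Nm^T).

(* On connected designs every r_i is positive, so [repl_mx] is invertible. *)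
Definition dual_intrablock : 'M[F]_b :=
  k%:R%:M - Nm^T *m invmx repl_mx *m Nm.

Definition unit_vec n (i : 'I_n) : 'cV[F]_n := delta_mx i 0.

Definition qform n (A : 'M[F]_n) (x : 'cV[F]_n) : F := (x^T *m A *m x) 0 0.

Definition V_cc (i i' : 'I_v) : F :=
  qform (mpinv intrablock) (unit_vec i - unit_vec i').

Definition V_tt (j j' : 'I_b) : F :=
  qform (mpinv dual_intrablock) (unit_vec j - unit_vec j').

Definition xi_vec (i : 'I_v) (j : 'I_b) : 'cV[F]_b :=
  unit_vec j - Nm^T *m invmx repl_mx *m unit_vec i.

Definition V_ct (i : 'I_v) (j : 'I_b) : F :=
  1 + (repl N i)%:R^-1 + qform (mpinv dual_intrablock) (xi_vec i j).

Definition A_cc : F :=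
  2 / (v%:R * (v%:R - 1)) *
    \sum_(i < v) \sum_(i' < v | (i < i')%N) V_cc i i'.

Definition A_tt (s : nat) : F :=
  2 + 2 * s%:R ^+ 2 / (b%:R * s%:R * (b%:R * s%:R - 1)) *
    \sum_(j < b) \sum_(j' < b | (j < j')%N) V_tt j j'.

Definition A_ct : F :=
  (v%:R * b%:R)^-1 * \sum_(i < v) \sum_(j < b) V_ct i j.

End Criteria.

Section Bounds.

Variables (F : realFieldType) (b v k : nat).

(* For v, b >= 2 a connected design with block size k satisfies k >= 2 and
   b * k >= v + b - 1, so on D(b, v, k) none of the denominators below is 0. *)
Definition Lbound : F := (v%:R - 1) ^+ 2 / (b%:R * (k%:R - 1)).

Definition Lbound_dual : F := (b%:R - 1) ^+ 2 / (b%:R * k%:R - v%:R).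

Definition Hbound : F :=
  let f := (b * k %/ v)%N in
  let h := (b * k - v * f)%N in
  h%:R / (f%:R + 1) + (v%:R - h%:R) / f%:R.

Definition A_cc_bound : F := 2 * Lbound / (v%:R - 1).

Definition A_tt_bound (s : nat) : F :=
  2 * (1 + s%:R / (b%:R * s%:R - 1) * Lbound_dual).

Definition A_ct_bound : F :=
  1 + (k%:R + 1) / (v%:R * k%:R) * Hbound + b%:R^-1 * Lbound_dual
    - (b%:R * k%:R)^-1.

End Bounds.

(* Main.v *)
(** Both C and its dual are weighted Laplacians of the bipartite incidence graph:
    each quadratic form is the sum over (i, j) of n_ij (x_i - m_j)^2, with m_j a
    weighted mean of x.  So each is positive semidefinite and, by connectedness,
    has kernel spanned by the all-ones vector; hence M W = W M = P, where M is the
    Laplacian, W its Moore-Penrose inverse and P = I - J/n.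
    For every t the matrix (M - t P) W (M - t P) = M - 2 t P + t^2 W is positive
    semidefinite.  Taking traces, tr M * tr W >= (n-1)^2, which gives (a) and (b)
    because n_ij^2 >= n_ij bounds tr M.  Taking t = k and using M <= k I gives
    W >= P / k, which handles the remaining quadratic term of (c).  Finally
    1/r lies above the chord of 1/x through f and f+1 at every positive integer r,
    whence the harmonic bound H. *)
Require Import Defs.
From mathcomp Require Import all_boot all_order all_algebra.
From mathcomp Require Import ring lra.

Import Order.TTheory GRing.Theory Num.Theory.

Local Open Scope ring_scope.

Set Implicit Arguments.
Unset Strict Implicit.
Unset Printing Implicit Defensive.

(** * Quadratic forms and auxiliary sums *)

Section QuadraticForms.

Variable F : realFieldType.

Lemma qformD n (A B : 'M[F]_n) x : qform (A + B) x = qform A x + qform B x.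
Proof. by rewrite /qform mulmxDr mulmxDl mxE. Qed.

Lemma qformZ n a (A : 'M[F]_n) x : qform (a *: A) x = a * qform A x.
Proof. by rewrite /qform -scalemxAr -scalemxAl mxE. Qed.

Lemma qformB n (A B : 'M[F]_n) x : qform (A - B) x = qform A x - qform B x.
Proof. by rewrite -scaleN1r qformD qformZ mulN1r. Qed.

Lemma qformE n (A : 'M[F]_n) x :
  qform A x = \sum_i \sum_j x i 0 * A i j * x j 0.
Proof.
rewrite /qform exchange_big mxE; apply: eq_bigr => j _ /=.
by rewrite mxE mulr_suml; apply: eq_bigr => i _; rewrite [x^T _ _]mxE.
Qed.

Lemma qform_mul m n (W : 'M[F]_m) (A : 'M_(m, n)) x :
  qform W (A *m x) = qform (A^T *m W *m A) x.
Proof. by rewrite /qform trmx_mul !mulmxA. Qed.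

Lemma form_unit_vec m n (A : 'M[F]_(m, n)) i j :
  ((unit_vec F i)^T *m A *m unit_vec F j) 0 0 = A i j.
Proof. by rewrite /unit_vec trmx_delta -rowE -colE !mxE. Qed.

Lemma qform_unit_vec n (A : 'M[F]_n) i : qform A (unit_vec F i) = A i i.
Proof. exact: form_unit_vec. Qed.

Lemma qform_sub n (W : 'M[F]_n) x y : W^T = W ->
  qform W (x - y) = qform W x + qform W y - 2 * (x^T *m W *m y) 0 0.
Proof.
move=> sW; have yWx : (y^T *m W *m x) 0 0 = (x^T *m W *m y) 0 0.
  transitivity ((y^T *m W *m x)^T 0 0); first by rewrite [RHS]mxE.
  by rewrite !trmx_mul sW trmxK mulmxA.
have mxB (A B : 'M[F]_1) : (A - B) 0 0 = A 0 0 - B 0 0 by rewrite !mxE.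
rewrite /qform [(x - y)^T]linearB /= !(mulmxBl, mulmxBr) !mxB yWx; ring.
Qed.

Lemma sum_sym_lt n (f : 'I_n -> 'I_n -> F) :
    (forall i j, f i j = f j i) -> (forall i, f i i = 0) ->
  \sum_i \sum_j f i j = 2 * \sum_(i < n) \sum_(j < n | (i < j)%N) f i j.
Proof.
move=> fC f0; rewrite mulr_natl mulr2n.
have -> : \sum_i \sum_j f i j =
    \sum_(i < n) \sum_(j < n | (i < j)%N) f i j
    + \sum_(i < n) \sum_(j < n | ~~ (i < j)%N) f i j.
  by rewrite -big_split; apply: eq_bigr => i _; exact: bigID.
(* The complementary sum is transposed; its diagonal vanishes, leaving the strict upper triangle
   again. *)
congr (_ + _); rewrite (exchange_big_dep predT) //=.
apply: eq_bigr => j _; rewrite (bigD1 j) ?ltnn //= f0 add0r.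
apply: eq_big => [i|i _]; last exact: fC.
by rewrite -leqNgt -val_eqE /= ltn_neqAle eq_sym andbC.
Qed.

(** Discriminant inequality that also covers [w = 0]: the quadratic is then affine with slope
    [- 2 * m < 0], hence negative somewhere. *)
Lemma quad_ge0_discr (a m w : F) : 0 < m -> 0 <= w ->
  (forall t, 0 <= a - 2 * t * m + t ^+ 2 * w) -> m ^+ 2 <= a * w.
Proof.
move=> m_gt0; rewrite le_eqVlt => /orP[/eqP <-|w_gt0] q_ge0.
  have /= := q_ge0 ((a + 1) / (2 * m)).
  have -> : a - 2 * ((a + 1) / (2 * m)) * m + ((a + 1) / (2 * m)) ^+ 2 * 0 = -1.
    by field; rewrite gt_eqF.
  by rewrite oppr_ge0 ler10.
(* The minimiser of the quadratic. *)
have := q_ge0 (m / w).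
have -> : a - 2 * (m / w) * m + (m / w) ^+ 2 * w = a - m ^+ 2 / w.
  by field; rewrite gt_eqF.
by rewrite subr_ge0 ler_pdivrMr.
Qed.

End QuadraticForms.

(** * Moore-Penrose inverses when the kernel is spanned by the all-ones vector *)

Section ConstantKernel.

Variables (F : realFieldType) (n : nat) (M W : 'M[F]_n).
Hypothesis W_mpinv : is_mpinv M W.
Hypothesis n_gt0 : (0 < n)%N.
Hypothesis M_sym : M^T = M.
Hypothesis M_psd : forall x, 0 <= qform M x.
Hypothesis M_one : M *m const_mx 1 = 0 :> 'cV_n.
Hypothesis M_ker : forall x : 'cV_n, M *m x = 0 -> exists c, x = const_mx c.

(** Orthogonal projection onto the vectors of coordinate sum zero. *)
Let P : 'M[F]_n := 1%:M - n%:R^-1 *: const_mx 1.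

(** Transposing the Penrose equations of a symmetric [M] shows that [W^T] solves them too. *)
Lemma mpinv_sym : W^T = W.
Proof.
have [] := W_mpinv => MWM WMW sMW sWM.
apply: (@is_mpinv_uniq _ _ _ M); last by split.
split.
- by rewrite -[RHS]M_sym -[in RHS]MWM !trmx_mul M_sym mulmxA.
- by rewrite -[RHS](congr1 trmx WMW) !trmx_mul M_sym mulmxA.
- by rewrite trmx_mul trmxK M_sym -sWM trmx_mul M_sym.
- by rewrite trmx_mul trmxK M_sym -sMW trmx_mul M_sym.
Qed.

Lemma mpinv_mulC : W *m M = M *m W.
Proof.
by have [_ _ <- _] := W_mpinv; rewrite trmx_mul M_sym mpinv_sym.
Qed.

(** [Q = 1 - M W] is symmetric and [M] annihilates its columns, so [M_ker] makes all its entries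
    equal; [Q] fixes the all-ones vector, so the common entry is [1/n]. *)
Lemma mul_mpinv : M *m W = P.
Proof.
have [MWM _ sMW _] := W_mpinv.
pose Q := 1%:M - M *m W.
have n0 : n%:R != 0 :> F by rewrite pnatr_eq0 -lt0n.
have Q_sym i j : Q i j = Q j i.
  by rewrite -[in LHS](_ : Q^T = Q) ?mxE // /Q linearB /= trmx1 sMW.
have MQ : M *m Q = 0 by rewrite mulmxBr mulmx1 -mpinv_mulC mulmxA MWM subrr.
have Qcol i i' j : Q i j = Q i' j.
  have [|c /colP Qc] := @M_ker (col j Q); first by rewrite colE mulmxA MQ mul0mx.
  by move: (Qc i) (Qc i'); rewrite !mxE => -> ->.
have Q1 : Q *m const_mx 1 = const_mx 1 :> 'cV_n.
  by rewrite mulmxBl mul1mx -mpinv_mulC -mulmxA M_one mulmx0 subr0.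
have QE i j : Q i j = n%:R^-1.
  move/colP/(_ i): Q1; rewrite mxE [RHS]mxE => Qi.
  apply: (mulIf n0); rewrite mulVf // mulr_natr -[RHS]Qi.
  rewrite (eq_bigr (fun=> Q i j)) => [|j' _].
    by rewrite sumr_const card_ord.
  by rewrite [const_mx _ _ _]mxE mulr1 (Q_sym i j') (Qcol j' j) (Q_sym j i).
rewrite /P -[LHS](subKr 1%:M) -/Q; congr (_ - _); apply/matrixP => i j.
by rewrite QE !mxE mulr1.
Qed.

Lemma qform_proj x :
  qform P x = \sum_i x i 0 ^+ 2 - n%:R^-1 * (\sum_i x i 0) ^+ 2.
Proof.
rewrite qformB qformZ; congr (_ - _ * _).
  rewrite /qform mulmx1 mxE; apply: eq_bigr => i _.
  by rewrite [x^T _ _]mxE expr2.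
rewrite qformE expr2 mulr_suml; apply: eq_bigr => i _; rewrite mulr_sumr.
by apply: eq_bigr => j _; rewrite mxE mulr1.
Qed.

Lemma mpinv_one : W *m const_mx 1 = 0 :> 'cV_n.
Proof.
have [_ <- _ _] := W_mpinv; rewrite -!mulmxA.
by rewrite [M *m _]mulmxA -mpinv_mulC -mulmxA M_one !mulmx0.
Qed.

(** As [W = W M W] with [W] symmetric, the form of [W] at [x] is that of [M] at [W x]. *)
Lemma qform_mpinv_ge0 x : 0 <= qform W x.
Proof.
have [_ WMW _ _] := W_mpinv.
by rewrite -[W]WMW -{1}mpinv_sym -qform_mul M_psd.
Qed.

Lemma proj_sym : P^T = P.
Proof. by rewrite -mul_mpinv; have [_ _ ->] := W_mpinv. Qed.

Lemma mul_proj : M *m P = M.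
Proof.
by rewrite -mul_mpinv -mpinv_mulC mulmxA; have [-> _ _ _] := W_mpinv.
Qed.

Lemma proj_mul : P *m M = M.
Proof. by rewrite -mul_mpinv; have [-> _ _ _] := W_mpinv. Qed.

Lemma proj_mpinv : P *m W = W.
Proof. by rewrite -mul_mpinv -mpinv_mulC; have [_ -> _ _] := W_mpinv. Qed.

Lemma mpinv_proj : W *m P = W.
Proof. by rewrite -mul_mpinv mulmxA; have [_ -> _ _] := W_mpinv. Qed.

Lemma proj_idem : P *m P = P.
Proof. by rewrite -{2}mul_mpinv mulmxA proj_mul mul_mpinv. Qed.

(** Nonnegativity of the left side yields both the trace inequality (all [t]) and the pointwise
    bound ([t = k]). *)
Lemma qform_mpinv_shift t x :
  qform W ((M - t *: P) *m x) = qform M x - 2 * t * qform P x + t ^+ 2 * qform W x.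
Proof.
rewrite qform_mul [(M - _)^T]linearB /= [(t *: _)^T]linearZ /= M_sym proj_sym.
rewrite !(mulmxBl, mulmxBr) -!(scalemxAl, scalemxAr) !mul_mpinv -mulmxA mpinv_mulC.
rewrite mul_mpinv proj_idem proj_mul proj_mpinv mpinv_proj.
rewrite !(qformB, qformD, qformZ); ring.
Qed.

(** Summing the shifted form over the unit vectors gives [tr M - 2 t (n - 1) + t^2 tr W],
    nonnegative for every [t]. *)
Lemma trace_mpinv_mul_ge : (1 < n)%N -> (n%:R - 1) ^+ 2 <= \tr M * \tr W.
Proof.
move=> n_gt1; apply: quad_ge0_discr => [||t].
- by rewrite subr_gt0 ltr1n.
- by apply: sumr_ge0 => i _; rewrite -qform_unit_vec qform_mpinv_ge0.
have trP : \tr P = n%:R - 1.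
  rewrite linearB linearZ /= mxtrace1; congr (_ - _).
  rewrite /mxtrace (eq_bigr (fun=> 1)) => [|i _]; last by rewrite mxE.
  by rewrite sumr_const card_ord mulVf // pnatr_eq0 -lt0n.
rewrite -trP /mxtrace !mulr_sumr -sumrB -big_split /=.
apply: sumr_ge0 => i _; rewrite -!qform_unit_vec -qform_mpinv_shift.
exact: qform_mpinv_ge0.
Qed.

(** For [n > 1] the product inequality forces both traces, hence [B], to be positive, which
    justifies the division. *)
Lemma trace_mpinv_ge (B : F) : (1 < n)%N -> \tr M <= B -> (n%:R - 1) ^+ 2 / B <= \tr W.
Proof.
move=> n_gt1 trB; have ineq := trace_mpinv_mul_ge n_gt1.
have m_gt0 : 0 < (n%:R - 1) ^+ 2 :> F by rewrite exprn_gt0 ?subr_gt0 ?ltr1n.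
have W_ge0 : 0 <= \tr W.
  by apply: sumr_ge0 => i _; rewrite -qform_unit_vec qform_mpinv_ge0.
have prod_gt0 := lt_le_trans m_gt0 ineq.
have W_gt0 : 0 < \tr W.
  by rewrite lt_def W_ge0 andbT; apply: contraTneq prod_gt0 => ->; rewrite mulr0 ltxx.
have M_gt0 : 0 < \tr M by rewrite pmulr_lgt0 in prod_gt0.
rewrite ler_pdivrMr ?(lt_le_trans M_gt0) // mulrC.
by apply: le_trans ineq _; rewrite ler_pM2r.
Qed.

(** Since [M = P M P] and [P] is idempotent, the hypothesis at [P x] gives [M <= k P] as forms;
    insert this into [0 <= M - 2 k P + k^2 W]. *)
Lemma qform_mpinv_ge (k : F) x : 0 < k ->
    (forall y, qform M y <= k * \sum_i y i 0 ^+ 2) ->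
  k^-1 * qform P x <= qform W x.
Proof.
move=> k_gt0 M_le; have := qform_mpinv_ge0 ((M - k *: P) *m x).
rewrite qform_mpinv_shift => ineq.
have MxE : qform M x = qform M (P *m x).
  by rewrite qform_mul proj_sym proj_mul mul_proj.
have PxE : qform P x = \sum_i (P *m x) i 0 ^+ 2.
  transitivity (qform 1%:M (P *m x)).
    by rewrite qform_mul proj_sym mulmx1 proj_idem.
  rewrite /qform mulmx1 mxE; apply: eq_bigr => i _.
  by rewrite [_^T _ _]mxE expr2.
have := M_le (P *m x); rewrite -MxE -PxE => Mx_le.
rewrite mulrC ler_pdivrMr // -(ler_pM2l k_gt0); lra.
Qed.

(** The row sums of [W] vanish, so the cross terms drop out of the full double sum, which is twice
    the sum over pairs. *)
Lemma sum_qform_mpinv_diff :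
  \sum_(i < n) \sum_(j < n | (i < j)%N) qform W (unit_vec F i - unit_vec F j)
    = n%:R * \tr W.
Proof.
have dE i j : qform W (unit_vec F i - unit_vec F j) = W i i + W j j - 2 * W i j.
  by rewrite (qform_sub _ _ mpinv_sym) !qform_unit_vec form_unit_vec.
have W_sum i : \sum_j W i j = 0.
  move/colP/(_ i): mpinv_one; rewrite !mxE => W1; rewrite -[RHS]W1.
  by apply: eq_bigr => j _; rewrite mxE mulr1.
have WC i j : W i j = W j i by rewrite -[in LHS]mpinv_sym mxE.
apply: (@mulfI _ 2); first by rewrite pnatr_eq0.
rewrite -sum_sym_lt => [|i j|i]; last 2 first.
- by rewrite !dE [W j i]WC; ring.
- by rewrite dE; ring.
rewrite (eq_bigr (fun i => n%:R * W i i + \tr W)) => [|i _]; last first.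
  rewrite (eq_bigr (fun j => W i i + W j j - 2 * W i j)) => [|j _]; last exact: dE.
  rewrite sumrB -mulr_sumr W_sum mulr0 subr0 big_split /=.
  by rewrite sumr_const card_ord mulr_natl.
rewrite big_split /= -mulr_sumr sumr_const card_ord -[_ *+ n]mulr_natl /mxtrace.
ring.
Qed.

End ConstantKernel.

(** * The weighted Laplacian of a design *)

Section DesignLaplacian.

Variable F : realFieldType.

Definition incidence_mx v b (N : 'M[nat]_(v, b)) : 'M[F]_(v, b) :=
  \matrix_(i, j) (N i j)%:R.

(** Block sizes may vary here, so that transposing [N] exchanges controls and blocks and one theory
    serves both [C] and its dual. *)
Definition laplacian v b (N : 'M[nat]_(v, b)) : 'M[F]_v :=
  repl_mx F N - incidence_mx N *m invmx (repl_mx F N^T) *m (incidence_mx N)^T.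

(** Functional form of connectedness: stable under transposition and directly usable for kernels. *)
Definition edge_rigid v b (N : 'M[nat]_(v, b)) : Prop :=
  forall (g : 'I_v -> F) (h : 'I_b -> F),
    (forall i j, (0 < N i j)%N -> g i = h j) ->
  exists c, (forall i, g i = c) /\ (forall j, h j = c).

Lemma incidence_mx_tr v b (N : 'M[nat]_(v, b)) :
  incidence_mx N^T = (incidence_mx N)^T.
Proof. by apply/matrixP => i j; rewrite !mxE. Qed.

Lemma edge_rigid_tr v b (N : 'M[nat]_(v, b)) : edge_rigid N -> edge_rigid N^T.
Proof.
move=> Nrig g h gh; have [i j|c [hc gc]] := Nrig h g; last by exists c.
by move=> Nij; rewrite (gh j i) // mxE.
Qed.

Lemma connected_edge_rigid v b (N : 'M[nat]_(v, b)) :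
  (0 < v)%N -> connected_design N -> edge_rigid N.
Proof.
case: v N => // v N _ Nconn g h gh.
pose u (x : 'I_v.+1 + 'I_b) := match x with inl i => g i | inr j => h j end.
have uE x : u x = g ord0.
  apply/eqP; rewrite -[_ == _]/(x \in [pred x | u x == g ord0]).
  (* The vertices where [u] equals [g ord0] form a set closed under adjacency. *)
  rewrite -(closed_connect _ (Nconn (inl ord0) x)) ?inE //= => {}x y.
  by rewrite !inE; case: x y => [i|j] [i'|j'] //= /gh ->.
by exists (g ord0); split=> [i|j]; [exact: (uE (inl i)) | exact: (uE (inr j))].
Qed.

Lemma qform_diag n (d : 'rV[F]_n) x :
  qform (diag_mx d) x = \sum_i d 0 i * x i 0 ^+ 2.
Proof.
rewrite /qform -mulmxA mul_diag_mx mxE; apply: eq_bigr => i _.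
by rewrite !mxE; ring.
Qed.

Section Rigid.

Variables (v b : nat) (N : 'M[nat]_(v, b)).
Hypotheses (b_gt0 : (0 < b)%N) (Nrig : edge_rigid N).

Lemma repl_gt0 i : (0 < repl N i)%N.
Proof.
rewrite lt0n sum_nat_eq0; apply/forallP => N0.
(* If row [i] is empty, the indicator of [i] on controls and zero on blocks agree along every edge
   without being constant. *)
have [|c [gc hc]] := Nrig (g := fun i' => (i' == i)%:R) (h := fun=> 0).
  move=> i' j; case: eqP => // ->.
  by move/(_ j)/eqP: N0 => /= ->.
move/eqP: (gc i); rewrite eqxx -(hc (Ordinal b_gt0)).
by rewrite oner_eq0.
Qed.

Let repl_neq0 i : (repl N i)%:R != 0 :> F.
Proof. by rewrite pnatr_eq0 -lt0n repl_gt0. Qed.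

Lemma repl_mx_unitE :
  repl_mx F N \in unitmx /\
  invmx (repl_mx F N) = diag_mx (\row_i (repl N i)%:R^-1).
Proof.
set D := diag_mx _; have RD : repl_mx F N *m D = 1%:M.
  rewrite /repl_mx mulmx_diag -diag_const_mx; congr diag_mx.
  by apply/rowP => i; rewrite !mxE mulfV.
by have [uR _] := mulmx1_unit RD; rewrite -[RHS](mulKmx uR) RD mulmx1.
Qed.

Lemma incidence_mx_one :
  incidence_mx N *m const_mx 1 = repl_mx F N *m const_mx 1 :> 'cV_v.
Proof.
rewrite mul_diag_mx; apply/colP => i; rewrite !mxE mulr1 natr_sum.
by apply: eq_bigr => j _; rewrite !mxE mulr1.
Qed.

End Rigid.

Variables (v b : nat) (N : 'M[nat]_(v, b)).
Hypotheses (v_gt0 : (0 < v)%N) (Nrig : edge_rigid N).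

Let Nrig_tr : edge_rigid N^T. Proof. exact: edge_rigid_tr. Qed.

Let block_neq0 j : (repl N^T j)%:R != 0 :> F.
Proof. by rewrite pnatr_eq0 -lt0n repl_gt0. Qed.

Lemma laplacian_sym : (laplacian N)^T = laplacian N.
Proof.
by rewrite /laplacian linearB /= !trmx_mul trmxK trmx_inv !tr_diag_mx mulmxA.
Qed.

Lemma laplacian_one : laplacian N *m const_mx 1 = 0 :> 'cV_v.
Proof.
rewrite mulmxBl -!mulmxA -incidence_mx_tr incidence_mx_one mulKmx.
  by rewrite incidence_mx_one subrr.
by have [] := repl_mx_unitE v_gt0 Nrig_tr.
Qed.

Lemma qform_laplacian x :
  qform (laplacian N) x =
    \sum_i (repl N i)%:R * x i 0 ^+ 2
    - \sum_j (\sum_i (N i j)%:R * x i 0) ^+ 2 / (repl N^T j)%:R.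
Proof.
have [_ invE] := repl_mx_unitE v_gt0 Nrig_tr.
rewrite qformB invE -{1}[incidence_mx N]trmxK -qform_mul !qform_diag.
congr (_ - _); first by apply: eq_bigr => i _; rewrite mxE.
apply: eq_bigr => j _; rewrite !mxE mulrC; congr (_ ^+ 2 / _).
by apply: eq_bigr => i _; rewrite !mxE.
Qed.

Let mean (x : 'cV[F]_v) j := (\sum_i (N i j)%:R * x i 0) / (repl N^T j)%:R.

(** Variance identity within each block, making positivity and the kernel visible. *)
Lemma qform_laplacian_sq x :
  qform (laplacian N) x = \sum_i \sum_j (N i j)%:R * (x i 0 - mean x j) ^+ 2.
Proof.
rewrite qform_laplacian (eq_bigr (fun i => \sum_j (N i j)%:R * x i 0 ^+ 2)).
  rewrite exchange_big [RHS]exchange_big -sumrB; apply: eq_bigr => j _ /=.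
  rewrite /mean; set S := \sum_i (N i j)%:R * x i 0.
  rewrite [RHS](eq_bigr (fun i => (N i j)%:R * x i 0 ^+ 2
      - 2 * (S / (repl N^T j)%:R) * ((N i j)%:R * x i 0)
      + (S / (repl N^T j)%:R) ^+ 2 * (N i j)%:R)) => [|i _]; last by ring.
  rewrite big_split sumrB /= -!mulr_sumr -/S -natr_sum.
  have -> : (\sum_i N i j)%N = repl N^T j by apply: eq_bigr => i _; rewrite mxE.
  by field.
by move=> i _; rewrite natr_sum mulr_suml.
Qed.

Lemma qform_laplacian_ge0 x : 0 <= qform (laplacian N) x.
Proof.
rewrite qform_laplacian_sq; do 2![apply: sumr_ge0 => ? _].
by rewrite mulr_ge0 ?ler0n ?sqr_ge0.
Qed.

(** Applied to [N^T] with blocks of size [k], this gives [M <= k I] for the dual matrix. *)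
Lemma qform_laplacian_le x :
  qform (laplacian N) x <= \sum_i (repl N i)%:R * x i 0 ^+ 2.
Proof.
rewrite qform_laplacian gerBl; apply: sumr_ge0 => j _.
by rewrite divr_ge0 ?sqr_ge0 ?ler0n.
Qed.

(** A vanishing sum of weighted squares forces [x] to equal the block mean along every edge;
    rigidity then applies. *)
Lemma laplacian_ker (x : 'cV_v) :
  laplacian N *m x = 0 -> exists c, x = const_mx c.
Proof.
move=> Lx0; have : qform (laplacian N) x = 0 by rewrite /qform -mulmxA Lx0 mulmx0 mxE.
rewrite qform_laplacian_sq => /eqP.
have term_ge0 i j : 0 <= (N i j)%:R * (x i 0 - mean x j) ^+ 2.
  by rewrite mulr_ge0 ?ler0n ?sqr_ge0.
rewrite psumr_eq0 => [|i _]; last exact: sumr_ge0.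
move/allP => sum0; have [i j Nij|c [xc _]] := Nrig (g := fun i => x i 0) (h := mean x).
  have := sum0 i (mem_index_enum i); rewrite psumr_eq0 //= => /allP.
  move/(_ j (mem_index_enum j)); rewrite /= mulf_eq0 pnatr_eq0 -leqn0 leqNgt Nij /=.
  by rewrite sqrf_eq0 subr_eq0 => /eqP.
by exists c; apply/colP => i; rewrite xc mxE.
Qed.

Lemma sum_repl_tr : (\sum_j repl N^T j = \sum_i repl N i)%N.
Proof.
rewrite /repl [RHS]exchange_big; apply: eq_bigr => j _.
by apply: eq_bigr => i _; rewrite mxE.
Qed.

Lemma trace_laplacian_le : \tr (laplacian N) <= (\sum_i repl N i)%N%:R - b%:R.
Proof.
have [_ invE] := repl_mx_unitE v_gt0 Nrig_tr.
rewrite linearB /= invE mxtrace_diag natr_sum lerB //.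
  by rewrite le_eqVlt; apply/orP; left; apply/eqP/eq_bigr => i _; rewrite mxE.
rewrite mul_mx_diag /mxtrace.
under eq_bigr => i _ do rewrite mxE.
rewrite exchange_big /= -[b in b%:R]card_ord -sumr_const ler_sum // => j _.
(* Each block contributes at least 1 to the subtracted trace: its proportions sum to 1, and
   [n <= n^2] for natural numbers. *)
have sum1 : \sum_i (N i j)%:R / (repl N^T j)%:R = 1 :> F.
  rewrite -mulr_suml -natr_sum; apply: etrans (mulfV (block_neq0 j)); congr (_%:R / _).
  by apply: eq_bigr => i _; rewrite mxE.
rewrite -[X in X <= _]sum1.
apply: ler_sum => i _; rewrite !mxE mulrAC ler_wpM2r ?invr_ge0 ?ler0n //.
by rewrite -natrM ler_nat; case: (N i j) => // n; rewrite leq_pmulr.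
Qed.

End DesignLaplacian.

(** * Reciprocal sums of positive integers with a given total *)

Section Harmonic.

Variable F : realFieldType.

(** The gap to the chord is [(r - f)(r - f - 1) / (r f (f + 1))], nonnegative because no integer
    lies strictly between [f] and [f + 1]. *)
Lemma inv_chord_le (f r : nat) : (0 < f)%N -> (0 < r)%N ->
  f%:R^-1 - (r%:R - f%:R) / (f%:R * (f%:R + 1)) <= r%:R^-1 :> F.
Proof.
move=> f_gt0 r_gt0.
have f0 : 0 < f%:R :> F by rewrite ltr0n.
have r0 : 0 < r%:R :> F by rewrite ltr0n.
have f1 : 0 < f%:R + 1 :> F by rewrite addr_gt0.
have int_ge0 : 0 <= (r%:R - f%:R) * (r%:R - (f%:R + 1)) :> F.
  have [rf|fr] := leqP r f.
    have rf' : r%:R <= f%:R :> F by rewrite ler_nat.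
    by rewrite mulr_le0 // subr_le0 // (le_trans rf') // lerDl.
  have fr' : f%:R + 1 <= r%:R :> F by rewrite natr1 ler_nat.
  by rewrite mulr_ge0 // subr_ge0 // (le_trans _ fr') // lerDl.
rewrite -subr_ge0.
have -> : r%:R^-1 - (f%:R^-1 - (r%:R - f%:R) / (f%:R * (f%:R + 1))) =
  (r%:R - f%:R) * (r%:R - (f%:R + 1)) / (r%:R * (f%:R * (f%:R + 1))) :> F.
  by field; rewrite !gt_eqF.
by rewrite divr_ge0 // !mulr_ge0 // ltW.
Qed.

(** The chord is affine in [r], so its sum depends only on the total [b k], and it evaluates exactly
    to [H]. *)
Lemma Hbound_le (b v k : nat) (r : 'I_v -> nat) : (0 < v)%N ->
    (forall i, (0 < r i)%N) -> (\sum_i r i = b * k)%N ->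
  Hbound F b v k <= \sum_i (r i)%:R^-1.
Proof.
move=> v_gt0 r_gt0 sum_r; rewrite /Hbound; set f := (b * k %/ v)%N.
have f_gt0 : (0 < f)%N.
  rewrite divn_gt0 // -sum_r -[v in (v <= _)%N]card_ord -sum1_card.
  by apply: leq_sum => i _; exact: r_gt0.
apply: le_trans (ler_sum _ (fun i _ => inv_chord_le f_gt0 (r_gt0 i))).
rewrite sumrB -mulr_suml sumrB !sumr_const card_ord -natr_sum sum_r.
rewrite natrB ?[(v * f)%N]mulnC ?leq_divM // natrM -[_ *+ v]mulr_natr.
rewrite -[_ *+ v]mulr_natr.
have f0 : 0 < f%:R :> F by rewrite ltr0n.
have f1 : 0 < f%:R + 1 :> F by rewrite addr_gt0.
by rewrite le_eqVlt; apply/orP; left; apply/eqP; field; rewrite !gt_eqF.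
Qed.

End Harmonic.

(** * The bounds for the three criteria *)

Section Bound.

Variables (F : realFieldType) (b v k : nat) (N : 'M[nat]_(v, b)).
Hypotheses (b_gt1 : (1 < b)%N) (v_gt1 : (1 < v)%N) (N_primal : primal k N).

Let v_gt0 : (0 < v)%N := ltnW v_gt1.
Let b_gt0 : (0 < b)%N := ltnW b_gt1.
Let Nrig : edge_rigid F N.
Proof. by apply: connected_edge_rigid => //; case: N_primal. Qed.
Let Nrig_tr : edge_rigid F N^T := edge_rigid_tr Nrig.

Lemma block_size j : repl N^T j = k.
Proof.
by case: N_primal => colN _; rewrite -(colN j); apply: eq_bigr => i _; rewrite mxE.
Qed.

Lemma block_size_gt0 : (0 < k)%N.
Proof. by rewrite -(block_size (Ordinal b_gt0)) (repl_gt0 v_gt0 Nrig_tr). Qed.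

Lemma sum_repl : (\sum_i repl N i = b * k)%N.
Proof.
rewrite -sum_repl_tr (eq_bigr (fun=> k)) => [|j _]; last exact: block_size.
by rewrite sum_nat_const card_ord.
Qed.

Lemma repl_mx_tr : repl_mx F N^T = k%:R%:M.
Proof.
rewrite /repl_mx -diag_const_mx; congr diag_mx; apply/rowP => j.
by rewrite !mxE block_size.
Qed.

Lemma intrablockE : intrablock F k N = laplacian F N.
Proof.
by rewrite /laplacian repl_mx_tr invmx_scalar -mulmxA mul_scalar_mx -scalemxAr.
Qed.

Lemma dual_intrablockE : dual_intrablock F k N = laplacian F N^T.
Proof.
by rewrite /laplacian repl_mx_tr trmxK incidence_mx_tr trmxK.
Qed.

Let natr_neq0 n : (0 < n)%N -> n%:R != 0 :> F.
Proof. by rewrite pnatr_eq0 lt0n. Qed.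

Let natr_sub1_gt0 n : (1 < n)%N -> 0 < n%:R - 1 :> F.
Proof. by rewrite subr_gt0 ltr1n. Qed.

Lemma trace_mpinv_intrablock_ge :
  Lbound F b v k <= \tr (mpinv (intrablock F k N)).
Proof.
rewrite intrablockE.
apply: (trace_mpinv_ge (mpinvP _) v_gt0 (laplacian_sym _ _)
  (qform_laplacian_ge0 v_gt0 Nrig) (laplacian_one v_gt0 Nrig)
  (laplacian_ker v_gt0 Nrig)) => //.
apply: le_trans (trace_laplacian_le v_gt0 Nrig) _.
by rewrite sum_repl natrM mulrBr mulr1.
Qed.

(** The dual has [v] blocks and the same total [b k], so its trace is at most [b k - v]. *)
Lemma trace_mpinv_dual_intrablock_ge :
  Lbound_dual F b v k <= \tr (mpinv (dual_intrablock F k N)).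
Proof.
rewrite dual_intrablockE.
apply: (trace_mpinv_ge (mpinvP _) b_gt0 (laplacian_sym _ _)
  (qform_laplacian_ge0 b_gt0 Nrig_tr) (laplacian_one b_gt0 Nrig_tr)
  (laplacian_ker b_gt0 Nrig_tr)) => //.
apply: le_trans (trace_laplacian_le b_gt0 Nrig_tr) _.
by rewrite sum_repl_tr sum_repl natrM.
Qed.

Lemma A_cc_ge : A_cc_bound F b v k <= A_cc F k N.
Proof.
have := trace_mpinv_intrablock_ge.
rewrite /A_cc /V_cc intrablockE.
rewrite (sum_qform_mpinv_diff (mpinvP _) (laplacian_sym _ _)
  (laplacian_one v_gt0 Nrig)).
move=> tr_ge; have := natr_sub1_gt0 v_gt1 => v1_gt0.
have -> t : 2 / (v%:R * (v%:R - 1)) * (v%:R * t) = 2 * t / (v%:R - 1) :> F.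
  by field; rewrite natr_neq0 // gt_eqF.
by rewrite ler_wpM2r ?invr_ge0 ?(ltW v1_gt0) // ler_wpM2l.
Qed.

Lemma A_tt_ge s : (0 < s)%N -> A_tt_bound F b v k s <= A_tt F k N s.
Proof.
move=> s_gt0; have := trace_mpinv_dual_intrablock_ge.
rewrite /A_tt /V_tt dual_intrablockE.
rewrite (sum_qform_mpinv_diff (mpinvP _) (laplacian_sym _ _)
  (laplacian_one b_gt0 Nrig_tr)).
move=> tr_ge; have bs1_gt0 : 0 < b%:R * s%:R - 1 :> F.
  by rewrite -natrM natr_sub1_gt0 // (leq_trans b_gt1) // leq_pmulr.
have -> t : 2 * s%:R ^+ 2 / (b%:R * s%:R * (b%:R * s%:R - 1)) * (b%:R * t) =
    2 * (s%:R / (b%:R * s%:R - 1) * t) :> F.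
  by field; rewrite !natr_neq0 // gt_eqF.
rewrite /A_tt_bound mulrDr mulr1 lerD2l ler_wpM2l // ler_wpM2l //.
by rewrite divr_ge0 ?ler0n ?(ltW bs1_gt0).
Qed.

Let W := mpinv (laplacian F N^T).
(** The distribution of control [i] over the blocks; [xi_vec] is a unit vector minus [z i]. *)
Let z i : 'cV[F]_b := (incidence_mx F N)^T *m invmx (repl_mx F N) *m unit_vec F i.

Lemma mean_vecE i j : z i j 0 = (N i j)%:R / (repl N i)%:R.
Proof.
have [_ invE] := repl_mx_unitE b_gt0 Nrig.
by rewrite /z invE mul_mx_diag -colE !mxE.
Qed.

(** Uses [W >= P / k]: the entries of [z i] sum to 1, and their squares sum to at least [1 / r_i] by
    integrality of the incidences. *)
Lemma qform_mean_ge i : k%:R^-1 * ((repl N i)%:R^-1 - b%:R^-1) <= qform W (z i).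
Proof.
have k_gt0 : 0 < k%:R :> F by rewrite ltr0n block_size_gt0.
have r_gt0 : 0 < (repl N i)%:R :> F by rewrite ltr0n (repl_gt0 b_gt0 Nrig).
have le_k y : qform (laplacian F N^T) y <= k%:R * \sum_j y j 0 ^+ 2.
  apply: le_trans (qform_laplacian_le b_gt0 Nrig_tr _) _; rewrite mulr_sumr.
  by apply: ler_sum => j _; rewrite block_size.
apply: le_trans (qform_mpinv_ge (mpinvP _) b_gt0 (laplacian_sym _ _)
  (qform_laplacian_ge0 b_gt0 Nrig_tr) (laplacian_one b_gt0 Nrig_tr)
  (laplacian_ker b_gt0 Nrig_tr) (z i) k_gt0 le_k).
rewrite ler_wpM2l ?invr_ge0 ?ler0n // qform_proj.
have z_sum : \sum_j z i j 0 = 1.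
  under eq_bigr => j _ do rewrite mean_vecE.
  by rewrite -mulr_suml -natr_sum mulfV ?gt_eqF.
rewrite z_sum expr1n mulr1 lerD2r.
have -> : (repl N i)%:R^-1 = \sum_j z i j 0 / (repl N i)%:R.
  by rewrite -mulr_suml z_sum mul1r.
apply: ler_sum => j _; rewrite mean_vecE expr2 mulrA ler_wpM2r ?invr_ge0 ?ler0n //.
rewrite mulrAC ler_wpM2r ?invr_ge0 ?ler0n //.
by rewrite -natrM ler_nat; case: (N i j) => // n; rewrite leq_pmulr.
Qed.

(** Summing over [j] removes the cross terms because [W] annihilates the all-ones vector. *)
Lemma sum_V_ct i :
  \sum_j V_ct F k N i j =
    b%:R * (1 + (repl N i)%:R^-1 + qform W (z i)) + \tr W.
Proof.
have W_sym : W^T = W := mpinv_sym (mpinvP _) (laplacian_sym _ _).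
have VE j : V_ct F k N i j =
    1 + (repl N i)%:R^-1 + qform W (z i) + W j j - 2 * (W *m z i) j 0.
  rewrite /V_ct dual_intrablockE -/W /xi_vec -/(incidence_mx F N) -/(z i).
  rewrite (qform_sub _ _ W_sym) qform_unit_vec -!addrA; do 2!congr (_ + _).
  rewrite [RHS]addrCA; do 2!congr (_ + _); congr (- (2 * _)).
  by rewrite -mulmxA /unit_vec trmx_delta -rowE mxE.
have sum0 : \sum_j (W *m z i) j 0 = 0.
  have W1 : (const_mx 1 : 'rV_b) *m W = 0.
    apply: trmx_inj; rewrite trmx_mul W_sym trmx_const trmx0.
    exact: mpinv_one (mpinvP _) (laplacian_sym _ _) (laplacian_one b_gt0 Nrig_tr).
  have : ((const_mx 1 : 'rV_b) *m (W *m z i)) 0 0 = 0 by rewrite mulmxA W1 mul0mx mxE.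
  rewrite mxE => sum_eq; rewrite -[RHS]sum_eq; apply: eq_bigr => j _.
  by rewrite [const_mx _ _ _]mxE mul1r.
rewrite (eq_bigr _ (fun j _ => VE j)) sumrB -mulr_sumr sum0 mulr0 subr0.
by rewrite big_split /= sumr_const card_ord mulr_natl.
Qed.

Lemma A_ct_ge : A_ct_bound F b v k <= A_ct F k N.
Proof.
have := trace_mpinv_dual_intrablock_ge; rewrite dual_intrablockE -/W => tr_ge.
have r_gt0 : forall i, (0 < repl N i)%N by exact: (repl_gt0 b_gt0 Nrig).
have H_le := Hbound_le F v_gt0 r_gt0 sum_repl.
set S := \sum_i _ in H_le.
have q_ge : k%:R^-1 * (S - v%:R / b%:R) <= \sum_i qform W (z i).
  apply: le_trans (ler_sum _ (fun i _ => qform_mean_ge i)).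
  by rewrite -mulr_sumr sumrB sumr_const card_ord mulr_natl.
have k0 := natr_neq0 block_size_gt0; have v0 := natr_neq0 v_gt0.
have b0 := natr_neq0 b_gt0.
rewrite /A_ct (eq_bigr _ (fun i _ => sum_V_ct i)) big_split /= -mulr_sumr.
rewrite !big_split /= !sumr_const !card_ord -/S -[\tr W *+ v]mulr_natr.
have -> q : (v%:R * b%:R)^-1 * (b%:R * (v%:R + S + q) + \tr W * v%:R)
    = 1 + v%:R^-1 * (S + q) + b%:R^-1 * \tr W :> F.
  by field; rewrite v0 b0.
have vV_ge0 : 0 <= v%:R^-1 :> F by rewrite invr_ge0 ler0n.
(* [H] enters twice, through [1 / r_i] and, scaled by [1 / k], through the form at [z i]; this is
   the source of the factor [(k + 1) / k]. *)
have -> : A_ct_bound F b v k = 1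
    + v%:R^-1 * (Hbound F b v k + k%:R^-1 * (Hbound F b v k - v%:R / b%:R))
    + b%:R^-1 * Lbound_dual F b v k.
  by rewrite /A_ct_bound; field; rewrite v0 b0 k0.
rewrite lerD ?ler_wpM2l ?invr_ge0 ?ler0n // lerD2l ler_wpM2l // lerD //.
by apply: le_trans q_ge; rewrite ler_wpM2l ?invr_ge0 ?ler0n // lerD2r.
Qed.

End Bound.

Theorem theorem1 (F : realFieldType) (b v k s : nat)
    (hb : (2 <= b)%N) (hv : (2 <= v)%N) (hk : (1 <= k)%N) (hs : (1 <= s)%N)
    (N : 'M[nat]_(v, b)) (hN : primal k N) :
  [/\ A_cc F k N >= A_cc_bound F b v k,
      A_tt F k N s >= A_tt_bound F b v k s
    & A_ct F k N >= A_ct_bound F b v k].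
Proof.
by split; [exact: A_cc_ge | exact: A_tt_ge | exact: A_ct_ge].
Qed.
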